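(* For all positive integers $k,m,n$, \[ \begin{aligned} &\#\{(\lambda,i_1,\dots,i_m) : \lambda\in\mathcal{SP}(n),\ 1\le i_1<\cdots<i_m\le\lambda_{\ell(\lambda)},\ a_{1,i_m}(\lambda)=k,\ \ell(\lambda)\text{ odd}\}\\ -&\#\{(\lambda,i_1,\dots,i_m) : \lambda\in\mathcal{SP}(n),\ 1\le i_1<\cdots<i_m\le\lambda_{\ell(\lambda)},\ a_{1,i_m}(\lambda)=k,\ \ell(\lambda)\text{ even}\}\\ =&\#\{(\lambda,t_1,\dots,t_{m-c(\lambda)}) : \lambda\in\mathcal{P}(n),\ \lambda_1=k,\ 1\le t_1<\cdots<t_{m-c(\lambda)}<\ell(\lambda),\ \lambda_{t_i}=\lambda_{t_i+1}\text{ for all } i\}. \end{aligned} \] (Here, for a given $\lambda$, if $m-c(\lambda)<0$ there are no such tuples, and if $m-c(\lambda)=0$ the empty tuple counts once.)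
   Context: A partition $\lambda$ of a positive integer $n$ is a sequence of integers $\lambda=(\lambda_1,\dots,\lambda_\ell)$ with $\lambda_1\ge\cdots\ge\lambda_\ell>0$ and $\sum_i\lambda_i=n$; $\ell(\lambda):=\ell$ is its length. $\mathcal{P}(n)$ is the set of partitions of $n$; $\lambda$ is strict if $\lambda_1>\cdots>\lambda_\ell>0$, and $\mathcal{SP}(n)$ is the set of strict partitions of $n$. The Young diagram is $Y(\lambda)=\{(i,j): 1\le i\le\ell,\ 1\le j\le\lambda_i\}$. The (shifted) arm length is $a_{ij}(\lambda):=\lambda_i-j+1$ (so $a_{1,j}(\lambda)=\lambda_1-j+1$). The set of corners is $C(\lambda)=\{(i,j)\in Y(\lambda): (i+1,j)\notin Y(\lambda),\ (i,j+1)\notin Y(\lambda)\}$ and $c(\lambda):=\#C(\lambda)$ (equivalently, the number of distinct part sizes of $\lambda$). *)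

(* Defs.v *)
From HB Require Import structures.
From mathcomp Require Import all_boot all_order all_algebra.

Set Implicit Arguments.
Unset Strict Implicit.
Unset Printing Implicit Defensive.

Definition is_partition_of (n : nat) (s : seq nat) : bool :=
  [&& sorted geq s, all (fun x => 0 < x) s & sumn s == n].

Record intpart (n : nat) := IntPart {
  parts :> seq nat;
  _ : is_partition_of n parts
}.

HB.instance Definition _ n := [isSub for @parts n].
HB.instance Definition _ n := [Countable of intpart n by <:].

(* Finiteness of [intpart n]: all parts, and their number, are at most n. *)
Lemma is_partition_size n s : is_partition_of n s -> size s <= n.
Proof.
case/and3P=> _ + /eqP <-; elim: s => //= x s IHs /andP[x_gt0 /IHs le_s].
by rewrite -add1n leq_add.
Qed.

Lemma is_partition_le n s : is_partition_of n s -> all (fun x => x <= n) s.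
Proof.
case/and3P=> _ _ /eqP <-; elim: s => //= x s IHs; rewrite leq_addr /=.
by apply: sub_all IHs => y /leq_trans; apply; apply: leq_addl.
Qed.

Definition intpart_encode n (la : intpart n) : n.-bseq 'I_n.+1 :=
  insub_bseq n [seq inord x | x <- parts la].

Definition intpart_decode n (b : n.-bseq 'I_n.+1) : option (intpart n) :=
  insub [seq nat_of_ord x | x <- b].

Lemma intpart_encodeK n : pcancel (@intpart_encode n) (@intpart_decode n).
Proof.
move=> la; rewrite /intpart_decode /intpart_encode /insub_bseq.
rewrite insubdK; last first.
  by rewrite -topredE /= size_map is_partition_size // (valP la).
rewrite -map_comp map_id_in ?valK // => x x_la /=.
by rewrite inordK // ltnS (allP (is_partition_le (valP la))).
Qed.

HB.instance Definition _ n : isFinite (intpart n) :=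
  PCanIsFinite (@intpart_encodeK n).

Definition strict (la : seq nat) : bool := sorted gtn la.

(* The i-th part, with i counted from 1. *)
Definition part (la : seq nat) (i : nat) : nat := nth 0 la i.-1.

Definition in_young (la : seq nat) (i j : nat) : bool :=
  [&& 1 <= i <= size la & 1 <= j <= part la i].

(* Only meaningful for (i, j) in the Young diagram, where the subtraction on
   nat does not truncate. *)
Definition arm (la : seq nat) (i j : nat) : nat := part la i - j + 1.

(* The Young diagram of a partition of n lies in [1, n] x [1, n], so letting
   i and j range over 'I_n.+1 loses no cell. *)
Definition corners (n : nat) (la : intpart n) : {set 'I_n.+1 * 'I_n.+1} :=
  [set c : 'I_n.+1 * 'I_n.+1 | [&& in_young la c.1 c.2,
                                   ~~ in_young la c.1.+1 c.2 &
                                   ~~ in_young la c.1 c.2.+1]].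

Definition ncorners (n : nat) (la : intpart n) : nat := #|corners la|.

Definition ordvals (N m : nat) (t : m.-tuple 'I_N) : seq nat :=
  [seq nat_of_ord x | x <- t].

(* Pairs (la, (i_1, ..., i_m)) with la a strict partition of n,
   1 <= i_1 < ... < i_m <= la_(l(la)) and a_(1, i_m)(la) = k.  Entries at most
   la_(l(la)) are at most n, hence the use of 'I_n.+1. *)
Definition strict_marked (k m n : nat) :
    {set intpart n * m.-tuple 'I_n.+1} :=
  [set x : intpart n * m.-tuple 'I_n.+1 |
    let la := x.1 in let i := ordvals x.2 in
    [&& strict la,
        sorted ltn i,
        all (fun j => 1 <= j <= part la (size la)) i &
        arm la 1 (last 0 i) == k]].

(* Pairs (la, (t_1, ..., t_(m - c(la)))).  The explicit condition c(la) <= m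
   discards the partitions for which the subtraction on nat would truncate;
   entries below l(la) are below n, hence the use of 'I_n.+1. *)
Definition repeat_marked (k m n : nat) :
    {set {la : intpart n & (m - ncorners la).-tuple 'I_n.+1}} :=
  [set x : {la : intpart n & (m - ncorners la).-tuple 'I_n.+1} |
    let la := tag x in let t := ordvals (tagged x) in
    [&& ncorners la <= m,
        part la 1 == k,
        sorted ltn t,
        all (fun j => 1 <= j < size la) t &
        all (fun j => part la j == part la j.+1) t]].

(* Main.v *)
Require Import Defs.
From mathcomp Require Import all_boot all_order all_algebra.
From mathcomp Require Import zify ring.

(* Summing over m with weight z^m and putting w = 1 + z, the left-hand side
   becomes the sum of (-1)^(l(la) - 1) z w^(la_1 - k) over the strict la whose
   parts lie in (la_1 - k, la_1], and the right-hand side the sum of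
   z^c(la) w^(l(la) - c(la)) over the la with la_1 = k.  With r = la_1 - k the
   generating function in q of the left-hand side is z q^k G_k, where
     G_k = \sum_r (w q)^r \prod_(0 < j < k) (1 - q^(r + j)),
   and reindexing r gives (1 - w q^(k+1)) G_(k+1) = (1 - q^k) G_k.  Hence
     (1 - w q^k) z q^k G_k = z q^k (1 + \sum_(0 < j < k) z q^j G_j),
   which is the recursion obtained on the other side by removing the largest
   part.  Power series are replaced by truncated sums, correct below q^N. *)

Set Implicit Arguments.
Unset Strict Implicit.
Unset Printing Implicit Defensive.

Import GRing.Theory.

(** * Counting strictly increasing tuples *)

Lemma count_iota_ord (N : nat) (P : pred nat) :
  #|[set i : 'I_N | P i]| = count P (iota 0 N).
Proof.
rewrite -sum1dep_card -sum1_count.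
have := big_mkord (op := addn) (idx := 0) (n := N) P (fun=> 1).
by rewrite /index_iota subn0 => ->.
Qed.

(** An increasing tuple is determined by its set of entries, so these tuples correspond to the
    [m]-subsets of the ordinals satisfying [P]. *)
Lemma card_ltn_sorted_tuples_all (N m : nat) (P : pred nat) :
  #|[set t : m.-tuple 'I_N | sorted ltn (ordvals t) && all P (ordvals t)]|
  = 'C(count P (iota 0 N), m).
Proof.
rewrite -count_iota_ord -cards_draws.
pose f (t : m.-tuple 'I_N) := [set i in t].
have f_inj : {in [set t : m.-tuple 'I_N |
    sorted ltn (ordvals t) && all P (ordvals t)] &, injective f}.
  move=> t u; rewrite !inE => /andP[t_inc _] /andP[u_inc _] /setP eq_tu.
  apply/val_inj/(inj_map val_inj)/(irr_sorted_eq ltn_trans ltnn) => // y.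
  by apply/mapP/mapP=> [] [x x_in ->]; exists x; move: (eq_tu x) x_in;
    rewrite !inE //= => ->.
rewrite -(card_in_imset f_inj); apply: eq_card => A.
rewrite inE; apply/imsetP/andP => [[t + ->]|[/subsetP A_P /eqP A_m]].
  rewrite inE => /andP[t_inc /allP t_P]; split.
    by apply/subsetP=> i; rewrite !inE => i_t; apply/t_P/map_f.
  rewrite cardsE (card_uniqP _) ?size_tuple // -(map_inj_uniq val_inj).
  exact: (sorted_uniq ltn_trans ltnn).
have val_t : tcast A_m (enum_tuple A) = enum A :> seq _ by rewrite val_tcast.
exists (tcast A_m (enum_tuple A)); last first.
  by apply/setP=> i; rewrite inE -[LHS]mem_enum -val_t.
rewrite inE /ordvals val_t; apply/andP; split.
  rewrite /enum_mem -enumT; apply: (subseq_sorted ltn_trans).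
    exact/map_subseq/filter_subseq.
  by rewrite val_enum_ord iota_ltn_sorted.
by apply/allP=> _ /mapP[i + ->]; rewrite mem_enum => /A_P; rewrite inE.
Qed.

Lemma ltn_sorted_all_geq (s : seq nat) (y : nat) :
  sorted ltn s -> all (geq y) s = (last 0 s <= y).
Proof.
case: s => //= x s; elim: s x y => [|z s IHs] x y /=; first by rewrite andbT.
case/andP=> lt_xz z_inc; rewrite IHs //; apply: andb_idl; apply: leq_trans.
apply/ltnW/(leq_trans lt_xz).
by have := IHs z (last z s) z_inc; rewrite leqnn => /andP[].
Qed.

(* The condition "last entry [x]" is the difference of "all entries at most
   [x]" and "all entries at most [x - 1]", so Pascal's rule gives the count. *)
Lemma card_ltn_sorted_tuples_last (N m x : nat) :
  0 < x < N ->
  #|[set t : m.+1.-tuple 'I_N | [&& sorted ltn (ordvals t),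
       all (leq 1) (ordvals t) & last 0 (ordvals t) == x]]| = 'C(x.-1, m).
Proof.
case/andP=> x_gt0 x_ltN.
pose T (y : nat) := [set t : m.+1.-tuple 'I_N | sorted ltn (ordvals t) &&
  all (fun j => 1 <= j <= y) (ordvals t)].
have cardT y : y < N -> #|T y| = 'C(y, m.+1).
  move=> ltyN; rewrite card_ltn_sorted_tuples_all; congr 'C(_, _).
  rewrite -[N](subnKC ltyN) iotaD count_cat /= add0n.
  rewrite [X in _ + X](_ : _ = 0) ?addn0; last first.
    apply/eqP; rewrite -leqn0 leqNgt -has_count; apply/hasPn=> j.
    by rewrite mem_iota; lia.
  rewrite -[RHS](size_iota 1 y); apply/eqP; rewrite -all_count.
  by apply/allP=> j; rewrite mem_iota; lia.
have inT y t : (t \in T y) =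
    [&& sorted ltn (ordvals t), all (leq 1) (ordvals t)
      & last 0 (ordvals t) <= y].
  rewrite inE; apply: andb_id2l => t_inc.
  by rewrite -ltn_sorted_all_geq // -all_predI.
set U := (X in #|pred_of_set X|).
have TU : T x = T x.-1 :|: U.
  apply/setP=> t; rewrite in_setU !inT /U inE -!andb_orr.
  by congr [&& _, _ & _]; lia.
have : #|T x| = #|T x.-1| + #|U|.
  rewrite TU cardsU [X in _ - #|pred_of_set X|](_ : _ = set0) ?cards0 ?subn0 //.
  apply/setP=> t; rewrite in_setI inT /U !inE.
  by apply/negP=> /andP[/and3P[_ _ ?] /and3P[_ _ /eqP]]; lia.
rewrite !cardT //; last lia.
by rewrite -{1}(prednK x_gt0) binS => /addnI.
Qed.

(** * Parts, corners and repeated parts of a partition *)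

Lemma intpartP n (la : intpart n) : is_partition_of n (parts la).
Proof. exact: valP. Qed.

Lemma part_default (s : seq nat) (i : nat) : size s < i -> part s i = 0.
Proof. by move=> ltsi; rewrite /part nth_default //; lia. Qed.

Lemma intpart_gt0 n (la : intpart n) (i : nat) :
  1 <= i <= size la -> 0 < part la i.
Proof.
case/and3P: (intpartP la) => _ /allP la_gt0 _ hi.
by apply/la_gt0/mem_nth; case: i hi.
Qed.

Lemma part_le n (la : intpart n) (i : nat) : part la i <= n.
Proof.
have [/part_default->//|] := ltnP (size la) i; case: i => [|i] hi.
  rewrite /part /=; case: (parts la) (is_partition_le (intpartP la)) => //= x s.
  by case/andP.
exact/(allP (is_partition_le (intpartP la)))/mem_nth.
Qed.

Lemma part_anti n (la : intpart n) (i j : nat) :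
  1 <= i -> i <= j -> part la j <= part la i.
Proof.
move=> i_gt0 leij; have [/part_default->//|lej] := ltnP (size la) j.
case/and3P: (intpartP la) => la_geq _ _; rewrite /part.
apply: (sorted_leq_nth (leT := geq)); rewrite ?inE //; try lia.
  by move=> x y z /=; lia.
exact: leqnn.
Qed.

Lemma part_size_gt0 n (la : intpart n) : 0 < n -> 0 < size la.
Proof.
by case/and3P: (intpartP la) => _ _ /eqP; case: (parts la) => //= ->.
Qed.

(** As [part] is 0 past the end, the last row of a partition always counts, and the total is the
    number of distinct part sizes. *)
Definition descents (s : seq nat) : nat :=
  count (fun i => part s i.+1 < part s i) (iota 1 (size s)).

Lemma descents_le (s : seq nat) : descents s <= size s.
Proof. by rewrite -[X in _ <= X](size_iota 1) count_size. Qed.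

Lemma part_cons x s i : 0 < i -> part (x :: s) i.+1 = part s i.
Proof. by case: i. Qed.

Lemma descents_cons x s : descents (x :: s) = (part s 1 < x) + descents s.
Proof.
rewrite /descents /=; congr (_ + _).
rewrite (iotaDl 1 1) count_map.
apply: eq_in_count => i; rewrite mem_iota => hi /=.
by rewrite add1n !part_cons //; lia.
Qed.

Lemma count_iota_sub N a l (P : pred nat) : a + l <= N ->
  count (fun i => (a <= i < a + l) && P i) (iota 0 N) = count P (iota a l).
Proof.
move=> leN; rewrite (_ : N = a + (l + (N - (a + l)))); last lia.
rewrite !iotaD !count_cat /= add0n.
rewrite [X in X + _](_ : _ = 0) ?add0n; last first.
  apply/eqP; rewrite -leqn0 leqNgt -has_count.
  by apply/hasPn=> j; rewrite mem_iota; lia.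
rewrite [X in _ + X](_ : _ = 0) ?addn0; last first.
  apply/eqP; rewrite -leqn0 leqNgt -has_count.
  by apply/hasPn=> j; rewrite mem_iota; lia.
by apply: eq_in_count => i; rewrite mem_iota => ->.
Qed.

(** Row [i] has a corner exactly when the next row is shorter, and then only in column [part la i];
    [f] sends each such row to its corner. *)
Lemma ncorners_descents n (la : intpart n) : ncorners la = descents la.
Proof.
pose D := [set i : 'I_n.+1 |
  (1 <= i < 1 + size la) && (part la i.+1 < part la i)].
pose f (i : 'I_n.+1) := (i, inord (part la i) : 'I_n.+1).
have f_inj : injective f by move=> i j [].
rewrite /ncorners (_ : corners la = f @: D); last first.
  apply/setP=> [[i j]]; apply/idP/imsetP => [|[{}i + [-> ->]]]; rewrite !inE /=.
    rewrite /in_young /= => h.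
    have := @part_default la i.+1 => hdef; exists i; last first.
      by congr pair; apply: val_inj; rewrite /= inordK ?ltnS ?part_le //; lia.
    by rewrite inE; lia.
  move=> h; have := @intpart_gt0 _ la i => h0.
  by rewrite /in_young /= inordK ?ltnS ?part_le //; lia.
pose P i := (1 <= i < 1 + size la) && (part la i.+1 < part la i).
rewrite card_imset // (count_iota_ord n.+1 P) count_iota_sub // add1n ltnS.
exact/is_partition_size/(intpartP la).
Qed.

(** The rows that are not descents are the repeats. The last row is always a descent, which agrees
    with the strict bound [j < size la]. *)
Lemma count_repeats n (la : intpart n) :
  count (fun j => (1 <= j < size la) && (part la j == part la j.+1))
    (iota 0 n.+1)
  = size la - descents la.
Proof.
have le_size := is_partition_size (intpartP la).
have := count_predC (fun i => part la i.+1 < part la i) (iota 1 (size la)).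
rewrite size_iota -/(descents la) => /(canRL (addKn _)) <-.
rewrite -[RHS](@count_iota_sub n.+1) ?add1n ?ltnS //.
apply: eq_in_count => i _ /=; rewrite ltnS -leqNgt.
have := @part_default la i.+1; have := @intpart_gt0 _ la i.
have := @part_anti _ la i i.+1.
lia.
Qed.

(** * Both sides as binomial sums over partitions *)

Lemma card_repeat_marked (k m n : nat) :
  #|repeat_marked k m n| = \sum_(la : intpart n | part la 1 == k)
    (if descents la <= m
     then 'C(size la - descents la, m - descents la) else 0).
Proof.
pose Q (la : intpart n) (t : (m - ncorners la).-tuple 'I_n.+1) :=
  (ncorners la <= m) && (sorted ltn (ordvals t) &&
    all (fun j => (1 <= j < size la) && (part la j == part la j.+1))
      (ordvals t)).
transitivity (\sum_(la : intpart n | part la 1 == k)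
    \sum_(t : (m - ncorners la).-tuple 'I_n.+1 | Q la t) 1); last first.
  apply: eq_bigr => la _; rewrite /Q ncorners_descents; case: ifP => _ /=.
    by rewrite sum1dep_card card_ltn_sorted_tuples_all count_repeats.
  by rewrite big_pred0.
rewrite sig_big_dep /= sum1dep_card /repeat_marked; apply: eq_card => -[la t].
rewrite !inE /Q /= andbCA; do 3!apply: andb_id2l => _.
by rewrite -[LHS]all_predI.
Qed.

(** The arm condition forces the last entry to be la_1 + 1 - k. It is admissible when it lies
    between 1 and the smallest part; the other [m] entries are then any of the la_1 - k smaller
    values. *)
Lemma card_marked k m n (la : intpart n) : 0 < k -> 0 < n ->
  #|[set t : m.+1.-tuple 'I_n.+1 | [&& sorted ltn (ordvals t),
      all (fun j => 1 <= j <= part la (size la)) (ordvals t) &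
      arm la 1 (last 0 (ordvals t)) == k]]|
  = if part la 1 - part la (size la) < k <= part la 1
    then 'C(part la 1 - k, m) else 0.
Proof.
move=> k_gt0 n_gt0; have size_gt0 := part_size_gt0 la n_gt0.
have le_last : part la (size la) <= part la 1 by apply: part_anti.
have le1 := part_le la 1.
rewrite [X in #|pred_of_set X|](_ : _ = [set t : m.+1.-tuple 'I_n.+1 |
   [&& part la 1 - part la (size la) < k <= part la 1, sorted ltn (ordvals t),
      all (leq 1) (ordvals t) & last 0 (ordvals t) == (part la 1).+1 - k]]).
  case: ifP => hk; last first.
    by apply/eqP; rewrite cards_eq0; apply/eqP/setP=> t; rewrite !inE.
  by rewrite /= card_ltn_sorted_tuples_last; [congr 'C(_, _)|]; lia.
apply/setP=> t; rewrite !inE [RHS]andbCA; apply: andb_id2l => t_inc.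
rewrite (@all_predI _ (leq 1) (geq (part la (size la)))).
rewrite ltn_sorted_all_geq // -!andbA.
rewrite [RHS]andbA [RHS]andbA [X in _ = X && _]andbC -!andbA.
apply: andb_id2l => t_gt0; rewrite /arm.
(* Positivity of the last entry is what yields k <= la_1. *)
have : 0 < last 0 (ordvals t).
  move: t_gt0; have : size (ordvals t) = m.+1 by rewrite size_map size_tuple.
  by case: (ordvals t) => // x s _ /allP; apply; exact: mem_last.
lia.
Qed.

Local Open Scope ring_scope.

Lemma signed_card_strict_marked (k m n : nat) : (0 < k)%N -> (0 < n)%N ->
  #|[set x in strict_marked k m.+1 n | odd (size x.1)]|%:Z
   - #|[set x in strict_marked k m.+1 n | ~~ odd (size x.1)]|%:Z
  = \sum_(la : intpart n | strict la &&
        (part la 1 - part la (size la) < k <= part la 1)%N)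
      (-1) ^+ (size la).+1 * 'C(part la 1 - k, m)%:Z.
Proof.
move=> k_gt0 n_gt0.
pose N (la : intpart n) : nat :=
  if (part la 1 - part la (size la) < k <= part la 1)%N
  then 'C(part la 1 - k, m) else 0.
(* The predicate [e] handles both parities at once. *)
have card (e : pred bool) :
   #|[set x in strict_marked k m.+1 n | e (odd (size x.1))]|
   = (\sum_(la : intpart n | strict la && e (odd (size la))) N la)%N.
  under eq_bigr => la _ do rewrite /N -card_marked // -sum1dep_card.
  rewrite pair_big_dep /= sum1dep_card; apply: eq_card => -[la t].
  by rewrite !inE /= andbAC.
transitivity (\sum_(la : intpart n | strict la)
    (-1) ^+ (size la).+1 * (N la)%:Z); last first.
  rewrite [RHS]big_mkcondr /=; apply: eq_bigr => la _.
  by rewrite /N; case: ifP; rewrite ?mulr0.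
rewrite (bigID (fun la : intpart n => odd (size la))) /=.
rewrite (card id) (card negb) /=.
rewrite !(big_morph Posz PoszD (erefl 0%:Z)) /=.
congr (_ + _); last rewrite -sumrN; apply: eq_bigr => la /andP[_ odd_la];
  by rewrite -signr_odd /= ?odd_la ?(negPf odd_la) ?mul1r ?expr1 ?mulN1r.
Qed.

(** * Strictly decreasing sequences with entries in an interval *)

Fixpoint strict_seqs (a k : nat) : seq (seq nat) :=
  if k is k'.+1 then
    strict_seqs a k' ++ [seq (a + k'.+1)%N :: s | s <- strict_seqs a k']
  else [:: [::]].

Lemma mem_strict_seqs a k s :
  (s \in strict_seqs a k) = sorted gtn s && all (fun x => a < x <= a + k)%N s.
Proof.
elim: k s => [|k IHk] s /=.
  case: s => [|x s]; rewrite inE //=; apply/esym/negbTE; lia.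
rewrite mem_cat IHk; case: s => [|x s]; first by [].
apply/orP/idP => [[]|].
- case/andP=> -> /allP h /=; apply/andP; split.
    by have := h x (mem_head _ _); lia.
  by apply/allP=> y ys; have := h y (mem_behead (s := x :: s) ys); lia.
- case/mapP=> t; rewrite IHk => /andP[t_gtn /allP t_in] [-> ->] /=.
  rewrite path_sortedE; last by move=> ? ? ?; rewrite /=; lia.
  rewrite t_gtn -andbA; apply/and4P; split=> //; try lia.
    by apply/allP=> y /t_in /=; lia.
  by apply/allP=> y /t_in /=; lia.
rewrite /= path_sortedE; last by move=> ? ? ?; rewrite /=; lia.
case/and3P=> /andP[/allP x_max s_gtn] x_in /allP s_in.
have s_all : all (fun y => a < y <= a + k)%N s.
  by apply/allP=> y ys; have := x_max y ys; have := s_in y ys; rewrite /=; lia.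
have [lex|ltx] := leqP x (a + k); [left | right].
  by rewrite s_gtn s_all !andbT; apply/andP; split; [exact/allP | lia].
by apply/mapP; exists s; [rewrite IHk s_gtn | congr cons; lia].
Qed.

Lemma strict_seqs_uniq a k : uniq (strict_seqs a k).
Proof.
elim: k => //= k IHk; rewrite cat_uniq IHk map_inj_uniq => [|s t []//].
rewrite IHk andbT.
apply/hasPn=> _ /mapP[s _ ->]; rewrite mem_strict_seqs /=.
by apply/negP=> /and3P[_ ? _]; lia.
Qed.

(** * q-Pochhammer products (q^a; q)_k and truncated q-series, with q = ['X] *)

Definition qprod (R : comNzRingType) (k a : nat) : {poly R} :=
  \prod_(j < k) (1 - 'X^(a + j)).

Lemma qprodSr (R : comNzRingType) (k a : nat) :
  qprod R k.+1 a = qprod R k a * (1 - 'X^(a + k)).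
Proof. by rewrite /qprod big_ord_recr. Qed.

Lemma qprodSl (R : comNzRingType) (k a : nat) :
  qprod R k.+1 a = (1 - 'X^a) * qprod R k a.+1.
Proof.
rewrite /qprod big_ord_recl /= addn0; congr (_ * _).
by apply: eq_bigr => j _; rewrite /bump /= addnA addn1.
Qed.

(** The truncation to r < N of G_(k+1); here [k] is the number of factors. *)
Definition qseries (R : comNzRingType) (w : R) (k N : nat) : {poly R} :=
  \sum_(r < N) w%:P ^+ r * 'X^r * qprod R k r.+1.

Lemma qseries_scale (R : comNzRingType) (z w : R) (k N : nat) :
  \sum_(r < N) (z * w ^+ r)%:P * 'X^(r + k.+1) * qprod R k r.+1
  = z%:P * ('X^(k.+1) * qseries w k N).
Proof.
rewrite /qseries !mulr_sumr; apply: eq_bigr => r _.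
by rewrite polyCM rmorphXn /= exprD; ring.
Qed.

Lemma qseries0 (R : comNzRingType) (w : R) (N : nat) :
  (1 - w%:P * 'X) * qseries w 0 N = 1 - w%:P ^+ N * 'X^N.
Proof.
elim: N => [|N IHN]; first by rewrite /qseries big_ord0 !expr0; ring.
rewrite /qseries big_ord_recr /= mulrDr -/(qseries w 0 N) IHN /qprod big_ord0.
by rewrite !exprS; ring.
Qed.

(** The recursion between consecutive G_k; the last term, a multiple of q^N, is the boundary term
    left by the truncation. *)
Lemma qseriesS (R : comNzRingType) (w : R) (k N : nat) :
  (1 - w%:P * 'X^(k.+2)) * qseries w k.+1 N
  = (1 - 'X^(k.+1)) * qseries w k N
    - w%:P ^+ N * 'X^(k.+1 + N) * qprod R k.+1 N.
Proof.
elim: N => [|N IHN]; first by rewrite qprodSl /qseries !big_ord0 !expr0; ring.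
rewrite /qseries !big_ord_recr /= !mulrDr -!/(qseries _ _ _) IHN.
(* Peeling a last factor or a first factor leaves [qprod R k N.+1] in every new term. *)
by rewrite (qprodSr R k N.+1) (qprodSl R k N) !exprD !exprS; ring.
Qed.

(** Since 1 - q^(k+1) = (1 - w q^(k+1)) + (w - 1) q^(k+1), each use of [qseriesS] adds one term to
    the sum. [Q] gathers the truncation errors, invisible below q^N. *)
Lemma qseries_eq (R : comNzRingType) (w : R) (k N : nat) : exists Q : {poly R},
  (1 - w%:P * 'X^(k.+1)) * qseries w k N
  = 1 + \sum_(j < k) (w - 1)%:P * 'X^(j.+1) * qseries w j N + 'X^N * Q.
Proof.
elim: k => [|k [Q IHk]].
  by exists (- w%:P ^+ N); rewrite big_ord0 expr1 qseries0; ring.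
exists (Q - w%:P ^+ N * 'X^(k.+1) * qprod R k.+1 N).
rewrite qseriesS big_ord_recr /=.
have -> : \sum_(j < k) (w - 1)%:P * 'X^(j.+1) * qseries w j N
    = (1 - w%:P * 'X^(k.+1)) * qseries w k N - 1 - 'X^N * Q.
  by rewrite IHk; ring.
by rewrite polyCB polyC1 exprD; ring.
Qed.

(** Expanding the product selects a subset of the exponents a + 1, ..., a + k, with one sign per
    chosen exponent. *)
Lemma qprod_strict_seqs (R : comNzRingType) (k a : nat) :
  qprod R k a.+1 = \sum_(s <- strict_seqs a k) (-1) ^+ size s * 'X^(sumn s).
Proof.
elim: k => [|k IHk]; first by rewrite /qprod big_ord0 /= big_seq1 expr0 mulr1.
rewrite qprodSr IHk /= big_cat big_map /= mulrBr mulr1; congr (_ + _).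
rewrite mulr_suml -sumrN; apply: eq_bigr => s _.
by rewrite !exprD !exprS; ring.
Qed.

(** * Sums over strict partitions as coefficients of q-series *)

Lemma eq_big_intpart (R : nmodType) n (P : pred (seq nat)) (F : seq nat -> R)
    (l : seq (seq nat)) :
    uniq l ->
    (forall s : seq nat, (s \in l) = is_partition_of n s && P s) ->
  \sum_(la : intpart n | P la) F la = \sum_(s <- l) F s.
Proof.
move=> l_uniq mem_l; rewrite -(big_map (@parts n) P F) -big_filter.
apply/perm_big/uniq_perm => // [|s].
  by rewrite filter_uniq // (map_inj_uniq val_inj) index_enum_uniq.
rewrite mem_filter mem_l andbC; congr (_ && _).
apply/mapP/idP => [[la _ ->]|s_part]; first exact: intpartP.
by exists (IntPart s_part); rewrite ?mem_index_enum.
Qed.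

Lemma sorted_gtn_all (a : nat) (x : nat) (s : seq nat) :
  sorted gtn (x :: s) ->
  all (leq a) (x :: s) = (a <= last x s)%N.
Proof.
elim: s x => [|y s IHs] x /=; first by rewrite andbT.
case/andP=> lt_yx y_dec; rewrite -IHs //=.
by apply: andb_idl => /andP[le_ay _]; lia.
Qed.

(** With r = la_1 - (k + 1), the condition says that all parts exceed r. So [la] is r + k + 1
    followed by a strict sequence in (r, r + k], and [qprod_strict_seqs] sums over these tails. *)
Lemma sum_strict_intpart (R : comNzRingType) (n k N : nat) (F : nat -> R) :
  (n < N)%N ->
  \sum_(la : intpart n | strict la &&
      (part la 1 - part la (size la) < k.+1 <= part la 1)%N)
    (-1) ^+ (size la).+1 * F (part la 1 - k.+1)%N
  = (\sum_(r < N) (F r)%:P * 'X^(r + k.+1) * qprod R k r.+1)`_n.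
Proof.
move=> ltnN.
pose l := [seq s <- [seq (r + k.+1)%N :: s | r <- iota 0 N,
                                             s <- strict_seqs r k]
   | sumn s == n].
rewrite (@eq_big_intpart _ n (fun s => strict s &&
    (part s 1 - part s (size s) < k.+1 <= part s 1)%N)
  (fun s => (-1) ^+ (size s).+1 * F (part s 1 - k.+1)%N) l).
- rewrite big_filter big_mkcond big_allpairs_dep /= coef_sum.
  have := big_mkord (op := +%R) (idx := 0 : R) (n := N) xpredT.
  rewrite /index_iota subn0 => ->; apply: eq_bigr => r _.
  rewrite qprod_strict_seqs mulr_sumr coef_sum; apply: eq_bigr => s _.
  rewrite /part /= addnK.
  have -> : (F r)%:P * 'X^(r + k.+1) * ((-1) ^+ size s * 'X^(sumn s))
     = (F r * (-1) ^+ size s)%:P * 'X^(r + k.+1 + sumn s).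
    by rewrite !polyCM rmorphXn /= polyCN polyC1 [in RHS]exprD; ring.
  rewrite coefCM coefXn eq_sym; case: eqP => _; last by rewrite mulr0.
  by rewrite mulr1 !exprS; ring.
- rewrite filter_uniq //; apply: allpairs_uniq_dep; first exact: iota_uniq.
    by move=> r _; apply: strict_seqs_uniq.
  by move=> [r s] [r' s'] _ _ /= [/addIn -> ->].
move=> s; rewrite mem_filter; apply/andP/andP => [[/eqP <-]|[]].
  case/allpairsPdep=> r [t [_ + ->]].
  rewrite mem_strict_seqs => /andP[t_dec /allP t_in].
  have dec : sorted gtn ((r + k.+1)%N :: t).
    rewrite /= path_sortedE => [|? ? ? /=]; last lia.
    rewrite t_dec andbT.
    by apply/allP=> y /t_in /=; lia.
  have := sorted_gtn_all r.+1 dec.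
  rewrite (_ : all _ _); last first.
    by apply/allP=> y; rewrite inE => /orP[/eqP->|/t_in]; lia.
  move=> /esym lt_last; split.
    apply/and3P; split=> //.
      by apply: sub_sorted dec => x y /=; lia.
    by apply/allP=> y; rewrite inE => /orP[/eqP->|/t_in]; lia.
  rewrite /strict dec /= /part /= -last_nth; lia.
case: s => [|x t]; first by move=> _ /and3P[].
case/and3P=> _ _ sum_n /andP[dec]; rewrite /part /= -last_nth => h; split=> //.
(* This bound with [n < N] puts r = x - (k + 1) in the range of the truncated sum. *)
have le_xn : (x <= n)%N by move: sum_n => /= /eqP <-; lia.
apply/allpairsPdep; exists (x - k.+1)%N, t; split; last by congr cons; lia.
  by rewrite mem_iota; lia.
rewrite mem_strict_seqs (path_sorted dec) /=.
have := sorted_gtn_all (x - k.+1).+1 dec.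
rewrite (_ : (_ < last x t)%N); last lia.
move=> /= /andP[_ /allP t_gt].
move: dec; rewrite /strict /= path_sortedE => [|? ? ? /=]; last lia.
case/andP=> /allP t_lt _; apply/allP=> y yt.
by have := t_gt y yt; have := t_lt y yt; rewrite /=; lia.
Qed.

(** * Generating polynomials by largest part *)

(** Here ['X] is z, so this is z^c w^(l - c). In [{poly {poly int}}] the outer variable is q. *)
Definition weight (s : seq nat) : {poly int} :=
  'X^(descents s) * (1 + 'X) ^+ (size s - descents s).

Definition weight_sum (k n : nat) : {poly int} :=
  \sum_(la : intpart n | part la 1 == k) weight la.

(** Repeating the largest part creates a repeat, hence a factor w; a larger new part creates a
    corner, hence a factor z. *)
Lemma weight_cons (x : nat) (s : seq nat) :
  (part s 1 <= x)%N ->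
  weight (x :: s) = (if part s 1 == x then 1 + 'X else 'X) * weight s.
Proof.
move=> le_x; rewrite /weight descents_cons /= ltn_neqAle le_x andbT.
have le_ds := descents_le s; case: eqP => _ /=.
  by rewrite add0n subSn // exprS; ring.
by rewrite add1n subSS exprS; ring.
Qed.

Lemma is_partition_cons (k n : nat) (s : seq nat) : (0 < k)%N ->
  is_partition_of (n + k) (k :: s) = is_partition_of n s && (part s 1 <= k)%N.
Proof.
move=> k_gt0; rewrite /is_partition_of /= k_gt0 /= addnC eqn_add2r.
by case: s => [|x s] /=; rewrite ?andbT // /part /= [RHS]andbC -!andbA.
Qed.

(** Remove the largest part k + 1: the next one is equal to it (factor w) or is some j <= k (factor
    z), with j = 0 for the empty remainder. *)
Lemma weight_sum_rec (k n : nat) :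
  weight_sum k.+1 (n + k.+1) =
  (1 + 'X) * weight_sum k.+1 n + 'X * \sum_(j < k.+1) weight_sum j n.
Proof.
pose l := [seq k.+1 :: parts mu | mu : intpart n <- index_enum (intpart n)
                                & (part mu 1 <= k.+1)%N].
rewrite /weight_sum (@eq_big_intpart _ _ (fun s => part s 1 == k.+1) weight l).
- rewrite big_map big_filter.
  rewrite (bigID (fun mu : intpart n => part mu 1 == k.+1)) /=.
  congr (_ + _).
    rewrite mulr_sumr; apply: eq_big => [mu|mu /andP[_ /eqP h]].
      by apply: andb_idl => /eqP->.
    by rewrite weight_cons h ?eqxx.
  rewrite mulr_sumr; under [RHS]eq_bigr => j _ do rewrite mulr_sumr.
  pose first_part (mu : intpart n) : 'I_k.+1 := inord (part mu 1).
  rewrite (partition_big first_part xpredT) //=.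
  apply: eq_bigr => j _.
  apply: eq_big => [mu|mu /andP[/andP[le_k /negPf ne_k] _]].
    (* If the first part exceeds k, [inord] returns a default, but both conditions are then
       false. *)
    have ltj := ltn_ord j; rewrite -val_eqE /first_part /=.
    by have [lt_k|ge_k] := ltnP (part mu 1) k.+1; [rewrite inordK //|]; lia.
  by rewrite weight_cons // ne_k.
- rewrite map_inj_uniq ?filter_uniq ?index_enum_uniq // => mu nu [].
  exact: val_inj.
move=> s; apply/mapP/andP => [[mu + ->]|[]].
  by rewrite mem_filter => /andP[le_k _]; rewrite is_partition_cons // intpartP.
case: s => [_|x s]; first by [].
move=> + /eqP; rewrite /part /= => + ex; rewrite {}ex is_partition_cons //.
case/andP=> s_part le_k; exists (IntPart s_part) => //.
by rewrite mem_filter mem_index_enum andbT.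
Qed.

Lemma weight_sum0 n : weight_sum 0 n = (n == 0)%:R.
Proof.
case: n => [|n]; last first.
  rewrite /weight_sum big_pred0 // => la; have := @intpart_gt0 _ la 1.
  by have := @part_size_gt0 _ la isT; lia.
pose P s := part s 1 == 0%N.
rewrite /weight_sum (@eq_big_intpart _ _ P weight [:: [::]]) //.
  by rewrite big_seq1 /weight /= !expr0 mulr1.
by case=> [|[|x] s] //=; rewrite inE /is_partition_of /= !andbF.
Qed.

Lemma weight_sum_small (k n : nat) : (n < k)%N -> weight_sum k n = 0.
Proof.
move=> ltnk; rewrite /weight_sum big_pred0 // => la.
by have := part_le la 1; lia.
Qed.

(** Strong induction on [n]: [weight_sum_rec] and [qseries_eq] give the same recursion for both
    sides. *)
Lemma weight_sum_qseries (N k n : nat) : (n < N)%N ->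
  weight_sum k.+1 n = 'X * ('X^(k.+1) * qseries (1 + 'X : {poly int}) k N)`_n.
Proof.
elim/ltn_ind: n k => n IHn k ltnN; rewrite coefXnM.
have [ltnk|] := ltnP n k.+1; first by rewrite weight_sum_small ?mulr0.
move=> /subnK def_n; rewrite -def_n addnK; set n' := (n - k.+1)%N in def_n *.
have lt_n : (n' < n)%N by lia.
have ltn'N : (n' < N)%N by lia.
(* The term j = 0, the empty partition, matches the constant 1 in [qseries_eq]. *)
rewrite weight_sum_rec big_ord_recl /= weight_sum0 IHn //.
have [Q] := qseries_eq (1 + 'X : {poly int}) k N.
move/(congr1 (fun p : {poly {poly int}} => p`_n')).
rewrite mulrBl mul1r coefB !coefD coef1 -[_%:P * _ * _]mulrA coefCM !coefXnM.
(* The error q^N Q has no coefficient at n' < N. *)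
rewrite ltn'N addr0 => /(canRL (subrK _)) ->.
have -> : \sum_(i < k) weight_sum (bump 0 i) n' =
   \sum_(i < k) ((1 + 'X - 1)%:P * 'X^(i.+1)
                  * qseries (1 + 'X : {poly int}) i N)`_n'.
  apply: eq_bigr => i _; rewrite /bump /= add1n IHn // -mulrA coefCM.
  by congr (_ * _); ring.
rewrite -coef_sum; ring.
Qed.

(** * Extracting the coefficients in z *)

Lemma coef_1X_exp (n i : nat) : ((1 + 'X : {poly int}) ^+ n)`_i = 'C(n, i)%:Z.
Proof.
elim: n i => [|n IHn] i; first by rewrite expr0 coef1; case: i.
rewrite exprS mulrDl mul1r coefD coefXM !IHn.
by case: i => [|i]; rewrite ?bin0 // binS PoszD.
Qed.

Lemma coef_weight m s :
  (weight s)`_m = (if (descents s <= m)%N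
     then 'C(size s - descents s, m - descents s) else 0)%N%:Z.
Proof. by rewrite /weight coefXnM ltnNge coef_1X_exp; case: leqP. Qed.

(** The generating form of the theorem in z: both sides are the q^n coefficient of z q^(k+1)
    G_(k+1). *)
Lemma weight_sum_strict (k n : nat) : (0 < n)%N ->
  weight_sum k.+1 n = \sum_(la : intpart n | strict la &&
      (part la 1 - part la (size la) < k.+1 <= part la 1)%N)
    (-1) ^+ (size la).+1 * ('X * (1 + 'X) ^+ (part la 1 - k.+1)).
Proof.
move=> n_gt0.
rewrite (@sum_strict_intpart _ n k n.+1 (fun r => 'X * (1 + 'X) ^+ r)) //.
by rewrite qseries_scale coefCM -(@weight_sum_qseries n.+1).
Qed.

Local Close Scope ring_scope.

Theorem theorem4p1 (k m n : nat) (hk : 0 < k) (hm : 0 < m) (hn : 0 < n) :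
  (#|[set x in strict_marked k m n | odd (size x.1)]|%:Z
   - #|[set x in strict_marked k m n | ~~ odd (size x.1)]|%:Z
   = #|repeat_marked k m n|%:Z)%R.
Proof.
case: k hk => // k _; case: m hm => // m _.
rewrite signed_card_strict_marked // card_repeat_marked.
rewrite (big_morph Posz PoszD (erefl _)).
transitivity (((weight_sum k.+1 n)`_m.+1)%R); last first.
  by rewrite coef_sum; apply: eq_bigr => la _; rewrite coef_weight.
rewrite weight_sum_strict // coef_sum; apply: eq_bigr => la _.
rewrite -[in RHS]signr_odd -[in LHS]signr_odd !mulr_sign.
(* The factor z lowers the index from m + 1 to m, leaving the binomial of la_1 - k - 1 over m. *)
by case: odd; rewrite ?coefN coefXM coef_1X_exp.
Qed.
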